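(* Let $r>s\ge 0$ and $i\ge 0$ be integers. There exists a bijection from the set of set partitions of $[r+s]$ of shape $(r,s)$ with interlacing number $i$ onto the set of standard Young tableaux of shape $(r+i,s-i)$.
   Context: The shape of a set partition is its list of block sizes in weakly decreasing order. Let $\mathbb{N}^*=\mathbb{N}\cup\{\infty\}$ with $\infty$ larger than all integers. Arcs $(a,b)$ and $(c,d)$ cross if $a<c<b<d$ or $c<a<d<b$. For a set $A=\{a_1<\dots<a_l\}$, its $j$-th arc is $(a_j,a_{j+1})$ for $j<l$ and $(a_l,\infty)$ for $j=l$. For a set partition with blocks $A_1,\dots,A_m$ (listed in increasing order of least elements), an interlacing is a pair consisting of the $j$-th arcs of $A_i$ and $A_{i'}$ that cross, for some $i<i'$ and $1\le j\le\min(|A_i|,|A_{i'}|)$; the interlacing number is the number of interlacings. A standard Young tableau of shape $(a,b)$ is a filling of the two-row Young diagram by $1,\dots,a+b$ with increasing rows and columns (empty set of such if $b<0$). *)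

(* Defs.v *)
From mathcomp Require Import all_boot all_order all_algebra.

Set Implicit Arguments.
Unset Strict Implicit.
Unset Printing Implicit Defensive.

(* N* = N u {oo} is encoded as [option nat], with [None] standing for oo. *)
Definition lt_inf (x y : option nat) : bool :=
  match x, y with
  | Some a, Some b => a < b
  | Some _, None => true
  | None, _ => false
  end.

Definition arc := (option nat * option nat)%type.

Definition cross (u v : arc) : bool :=
  [&& lt_inf u.1 v.1, lt_inf v.1 u.2 & lt_inf u.2 v.2]
  || [&& lt_inf v.1 u.1, lt_inf u.1 v.2 & lt_inf v.2 u.2].

(* The j-th arc (1 <= j <= size A) of a set listed increasingly as A; since
   [onth A (size A) = None], the last arc is (a_l, oo). *)
Definition jth_arc (A : seq nat) (j : nat) : arc := (onth A j.-1, onth A j).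

Definition block_pairs (bs : seq (seq nat)) : seq (seq nat * seq nat) :=
  [seq (nth [::] bs i, nth [::] bs i') | i' <- iota 0 (size bs), i <- iota 0 i'].

Definition interlacings (bs : seq (seq nat)) : seq (arc * arc) :=
  undup [seq uv <-
          [seq (jth_arc AB.1 j, jth_arc AB.2 j) |
             AB <- block_pairs bs, j <- iota 1 (minn (size AB.1) (size AB.2))]
        | cross uv.1 uv.2].

(* The ground set [n] = {1, ..., n} is modelled by 'I_n, with x : 'I_n standing
   for the integer x + 1. *)
Definition elements n (A : {set 'I_n}) : seq nat :=
  sort leq [seq (val x).+1 | x in A].

Definition blocks n (P : {set {set 'I_n}}) : seq (seq nat) :=
  sort (fun A B => head 0 A <= head 0 B) [seq elements A | A in P].

Definition interlacing_number n (P : {set {set 'I_n}}) : nat :=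
  size (interlacings (blocks P)).

Definition shape_of n (P : {set {set 'I_n}}) : seq nat :=
  sort geq [seq #|A| | A : {set 'I_n} in P].

(* As usual for integer partitions, zero parts are dropped: (r, 0) is (r). *)
Definition two_row_shape (r s : nat) : seq nat := [seq k <- [:: r; s] | 0 < k].

Definition setpart (r s i : nat) : Type :=
  {P : {set {set 'I_(r + s)}} |
    [&& partition P [set: 'I_(r + s)],
        shape_of P == two_row_shape r s
      & interlacing_number P == i]}.

(* T = (first row, second row); there is no such T when b < 0. *)
Definition is_syt2 (a b : int) (T : seq nat * seq nat) : bool :=
  [&& (size T.1)%:Z%R == a,
      (size T.2)%:Z%R == b,
      size T.2 <= size T.1,
      perm_eq (T.1 ++ T.2) (iota 1 (size T.1 + size T.2)),
      sorted ltn T.1,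
      sorted ltn T.2
    & all (fun j => nth 0 T.1 j < nth 0 T.2 j) (iota 0 (size T.2))].

Definition syt2 (a b : int) : Type := {T : seq nat * seq nat | is_syt2 a b T}.

(* Main.v *)
Require Import Defs.
From mathcomp Require Import all_boot all_order all_algebra zify.

(** Encode a partition of [r + s] into blocks of sizes [r > s] as a lattice path
    [p] from [0] to [r - s], going up at the elements of the large block.  The
    [j]-th arcs of the two blocks cross exactly when [p] returns to [0] at time
    [2j] and then leaves on the side it came from, so the interlacing number [i]
    counts these bounces.  Put [q t := |p t| + 2 * (number of bounces up to and
    including time t)].  Consecutive values of [q] differ by one, [q] is
    nonnegative and ends at [r - s + 2 i]: it is the ballot path of a tableau of
    shape [(r + i, s - i)].  Read backwards, [q] determines [p] step by step: at
    a zero of [p], an up-step of [q] is a bounce and a down-step a sign change. *)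

Set Implicit Arguments.
Unset Strict Implicit.
Unset Printing Implicit Defensive.

Import Order.TTheory GRing.Theory Num.Theory.

(** * Lattice paths, bounces and the passage to ballot paths *)

Implicit Types (u v : seq bool) (b c : bool) (X Y : seq nat).

(* Lattice paths are boolean words, [true] being an up-step, listed from the last
   step to the first, so that prefixes of a path are suffixes of its word. *)
Definition excess u : int := ((count id u)%:Z - (count negb u)%:Z)%R.

(* [bounces c u]: the path [u] ends at [0], and a further step [c] would reverse
   its last one (false when [u] is empty). *)
Definition bounces c u : bool := (excess u == 0%R) && (head c u != c).

Fixpoint bounce_count u : nat :=
  if u is c :: u' then bounces c u' + bounce_count u' else 0.

Fixpoint ballot v : bool :=
  if v is _ :: v' then (0 <= excess v)%R && ballot v' else true.

(* [c] is the step following [u]; it decides whether the end of [u] is a bounce. *)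
Fixpoint to_ballot c u : seq bool :=
  if u is a :: u' then
    (if excess u == 0%R then a != c else a == (0 < excess u)%R)
      :: to_ballot a u'
  else [::].

Lemma excess_cons c u : excess (c :: u) = ((if c then 1 else -1) + excess u)%R.
Proof. rewrite /excess /=; case: c; lia. Qed.

Lemma bounce_count_cons c u :
  bounce_count (c :: u) = bounces c u + bounce_count u.
Proof. by []. Qed.

Lemma bounce_count1 c : bounce_count [:: c] = 0.
Proof. by rewrite /= /bounces /= eqxx. Qed.

Lemma size_to_ballot c u : size (to_ballot c u) = size u.
Proof. by elim: u c => //= a u IHu c; rewrite IHu. Qed.

(** At a zero of the path [|excess u|] has just dropped by one, so the net change is +1 if the next
    step [c] makes a bounce and -1 otherwise; away from zero it is the change of [|excess u|]. *)
Lemma excess_to_ballot c u :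
  excess (to_ballot c u) = (`|excess u| + (bounce_count (c :: u)).*2%:Z)%R.
Proof.
elim: u c => [|a u IHu] c; first by rewrite bounce_count1.
rewrite [to_ballot _ _]/= excess_cons IHu (bounce_count_cons c).
rewrite /bounces [head c _]/= excess_cons.
move: (bounce_count (a :: u)) => k.
by case: a; case: c; case: eqP => /= ?; try case: ltP => /= ?; lia.
Qed.

Lemma ballot_to_ballot c u : ballot (to_ballot c u).
Proof.
elim: u c => [|a u IHu] c //.
apply/andP; split; last exact: IHu.
by rewrite -/(to_ballot c (a :: u)) excess_to_ballot; lia.
Qed.

(** The end height, the next step [c] and the last step of the image determine the last step [a] of
    the path, hence the height before it; [a] is then the next step for the rest. *)
Lemma to_ballot_inj c u u' :
  excess u = excess u' -> to_ballot c u = to_ballot c u' -> u = u'.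
Proof.
elim: u u' c => [|a u IHu] [|a' u'] c //= eqE [].
rewrite -eqE => eqa.
have {}eqa : a = a'.
  move: eqa; move: (excess _ == _) (0 < excess _)%R.
  by case: (a); case: (a'); case: (c) => - [] [].
move: eqE; rewrite -{}eqa !excess_cons => /addrI eqE eq_tl.
by rewrite (IHu _ _ eqE eq_tl).
Qed.

Lemma to_ballot_surj c v (e : int) k :
  ballot v -> excess v = (`|e| + k.*2%:Z)%R ->
  exists u, [/\ excess u = e, bounce_count (c :: u) = k & to_ballot c u = v].
Proof.
elim: v c e k => [|d v IHv] c e k.
  rewrite /excess [count _ _]/= => _ E.
  by exists [::]; split; rewrite ?bounce_count1 // /excess /=; lia.
move=> /= /andP[_ bal]; rewrite excess_cons => E.
have Ev : (0 <= excess v)%R by case: (v) bal => //= ? ? /andP[].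
(* [a] is the only last step whose image is [d]; [e'] and [k'] are the height and the number of
   bounces that remain. By [Ev], [k] is positive whenever a bounce is removed, so the subtraction is
   exact. *)
pose a := if e == 0%R then d != c else d == (0 < e)%R.
pose e' : int := (e - (if a then 1 else -1))%R.
pose k' := k - ((e == 0%R) && d).
have [|u [Ee Ek Eu]] := IHv a e' k' bal.
  rewrite /e' /k' /a; move: E.
  by case: (e =P 0%R) => /= ?; case: (d); case: (c) => /=;
     try case: (ltP 0%R e) => /= ?; lia.
have Eau : excess (a :: u) = e by rewrite excess_cons Ee /e'; lia.
exists (a :: u); split=> //.
  rewrite -[LHS]/(bounces c (a :: u) + bounce_count (a :: u)) Ek.
  rewrite /bounces Eau /k' /a /=; move: E.
  by case: (e =P 0%R) => /= ?; case: (d); case: (c) => /=; lia.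
rewrite /= Eu Eau; congr cons; rewrite /a.
by case: (e == 0%R); case: (d); case: (c); case: (0 < e)%R.
Qed.

(** * Positions of the steps; ballot words as two-row tableaux *)

Local Arguments onth : simpl never.

(** Words start with the last step, so the head is step number [size u] and the list comes out
    increasing. *)
Fixpoint positions b u : seq nat :=
  if u is c :: u' then
    if c == b then rcons (positions b u') (size u) else positions b u'
  else [::].

Lemma size_positions b u : size (positions b u) = count_mem b u.
Proof. by elim: u => //= c u IHu; case: eqP => _; rewrite ?size_rcons IHu. Qed.

Lemma excess_positions u :
  excess u = ((size (positions true u))%:Z - (size (positions false u))%:Z)%R.
Proof.
rewrite !size_positions /excess; congr (_%:Z - _%:Z)%R.
  by apply: eq_count; case.
by apply: eq_count; case.
Qed.

Lemma positions_rev_map b (p : pred nat) n :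
  positions b (rev (map p (iota 1 n))) = [seq k <- iota 1 n | p k == b].
Proof.
elim: n => // n IHn.
rewrite -(addn1 n) iotaD map_cat rev_cat filter_cat /= -IHn add1n.
by case: eqP => _; rewrite ?cats0 ?cats1 // size_rev size_map size_iota.
Qed.

Lemma positions_filter b u :
  positions b u = [seq k <- iota 1 (size u) | nth false (rev u) k.-1 == b].
Proof.
rewrite -positions_rev_map (iotaDl 1 0) -map_comp; congr positions.
by rewrite -[LHS]revK -[in LHS](mkseq_nth false (rev u)) size_rev.
Qed.

Lemma mem_positions b u k : k \in positions b u -> 0 < k <= size u.
Proof. by rewrite positions_filter mem_filter mem_iota; lia. Qed.

Lemma sorted_positions b u : sorted ltn (positions b u).
Proof.
by rewrite positions_filter sorted_filter ?iota_ltn_sorted //; exact: ltn_trans.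
Qed.

Lemma perm_positions u :
  perm_eq (positions true u ++ positions false u) (iota 1 (size u)).
Proof.
rewrite !positions_filter.
under eq_filter do rewrite eqb_id.
under [X in _ ++ X]eq_filter do rewrite eqbF_neg.
by rewrite perm_filterC.
Qed.

Lemma size_positionsD u :
  size (positions true u) + size (positions false u) = size u.
Proof. by have := perm_size (perm_positions u); rewrite size_cat size_iota. Qed.

Lemma positions_true_inj u v :
  size u = size v -> positions true u = positions true v -> u = v.
Proof.
move=> eq_sz eq_pos; apply: (can_inj revK).
apply: (@eq_from_nth _ false); rewrite !size_rev // => k ltk.
have: (k.+1 \in positions true u) = (k.+1 \in positions true v).
  by rewrite eq_pos.
rewrite !positions_filter !mem_filter !mem_iota /= -eq_sz.
by rewrite !eqb_id add1n !ltnS ltk !andbT.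
Qed.

Definition column_strict X Y :=
  (size Y <= size X) && all (fun j => nth 0 X j < nth 0 Y j) (iota 0 (size Y)).

(** A last up-step leaves the columns alone. A last down-step fills column [size Y], whose upper
    entry exists exactly when the path stays nonnegative, and is then below the new maximum. *)
Lemma column_strict_positions u :
  column_strict (positions true u) (positions false u) = ballot u.
Proof.
elim: u => //= c u IHu; rewrite -/(positions true u).
have leX k : k < size (positions true u) -> nth 0 (positions true u) k <= size u.
  by move=> ltk; have /andP[] := mem_positions (mem_nth 0 ltk).
have leY k : k < size (positions false u) -> nth 0 (positions false u) k <= size u.
  by move=> ltk; have /andP[] := mem_positions (mem_nth 0 ltk).
rewrite excess_cons excess_positions -IHu.
move: (positions true u) (positions false u) leX leY => X Y leX leY.
case: c; rewrite /= /column_strict size_rcons.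
  apply/idP/idP.
    move=> /andP[leYX /allP H].
    have leYX' : size Y <= size X.
      rewrite leqNgt; apply/negP => ltXY.
      (* Otherwise column [size X] would have the new maximum above an entry of [Y]. *)
      have := H (size X); rewrite mem_iota ltXY nth_rcons ltnn eqxx => /(_ isT).
      by have := leY _ ltXY; lia.
    rewrite leYX' /=; apply/andP; split; first lia.
    apply/allP => j jY; have := H j jY; rewrite nth_rcons.
    by move: jY; rewrite mem_iota => jY; rewrite (_ : j < size X); last lia.
  move=> /and3P[_ leYX /allP H]; apply/andP; split; first lia.
  apply/allP => j jY; have := H j jY; rewrite nth_rcons.
  by move: jY; rewrite mem_iota => jY; rewrite (_ : j < size X); last lia.
rewrite -(addn1 (size Y)) iotaD all_cat /= nth_rcons ltnn eqxx andbT add0n.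
have eqa : all (fun j => nth 0 X j < nth 0 (rcons Y (size u).+1) j)
             (iota 0 (size Y)) =
           all (fun j => nth 0 X j < nth 0 Y j) (iota 0 (size Y)).
  by apply: eq_in_all => j; rewrite mem_iota nth_rcons => /andP[_ ->].
rewrite eqa; case: all; rewrite ?andbF //= !andbT.
case: (ltnP (size Y) (size X)) => ltYX; last lia.
by have := leX _ ltYX; lia.
Qed.

(** * Crossing arcs of two sets, and bounces *)

Definition interlace X Y : nat :=
  count (fun j => cross (jth_arc X j) (jth_arc Y j))
        (iota 1 (minn (size X) (size Y))).

Lemma crossC : commutative cross.
Proof. by move=> x y; rewrite /cross orbC. Qed.

Lemma interlaceC : commutative interlace.
Proof.
by move=> X Y; rewrite /interlace minnC; apply: eq_count => j; rewrite crossC.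
Qed.

(** One of the two arcs starts at infinity. The range of [j] can thus be enlarged, so that counts
    for lists of different sizes become comparable. *)
Lemma cross_default X Y j :
  minn (size X) (size Y) < j -> cross (jth_arc X j) (jth_arc Y j) = false.
Proof.
case: j => // j; rewrite ltnS geq_min /cross /jth_arc /=.
by case/orP=> /onth_default ->; rewrite /= ?andbF.
Qed.

Lemma interlace_widen n X Y : minn (size X) (size Y) <= n ->
  interlace X Y = count (fun j => cross (jth_arc X j) (jth_arc Y j)) (iota 1 n).
Proof.
move=> len; rewrite -(subnKC len) iotaD count_cat -[LHS]addn0; congr (_ + _).
rewrite (eq_in_count (a2 := pred0)) ?count_pred0 // => j.
by rewrite mem_iota => /andP[ltj _]; rewrite cross_default //; lia.
Qed.

Lemma onth_rcons (T : Type) (s : seq T) x j :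
  onth (rcons s x) j =
  if j < size s then onth s j else if j == size s then Some x else None.
Proof.
rewrite -cats1 onth_cat; case: ltnP => // le; case: eqP => [->|ne].
  by rewrite subnn.
by rewrite onth_default //=; lia.
Qed.

Lemma onth_some (T : Type) (x0 : T) (s : seq T) j :
  j < size s -> onth s j = Some (nth x0 s j).
Proof. by move=> lt; rewrite onthE (nth_map x0). Qed.

(* Appending a new maximum to [X] only affects the arcs of index [size X], and
   only if the path was at height [0]. *)
Lemma cross_rcons X Y n j : 0 < j -> {in X, forall k, k <= n} ->
    {in Y, forall k, k <= n} ->
  cross (jth_arc (rcons X n.+1) j) (jth_arc Y j) =
  cross (jth_arc X j) (jth_arc Y j)
    (+) [&& j == size X, size X == size Y & last 0 X < last 0 Y].
Proof.
case: j => // j _ leX leY; rewrite /jth_arc /= !onth_rcons.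
have leYn k : k < size Y -> nth 0 Y k <= n by move=> lt; apply/leY/mem_nth.
have leXn k : k < size X -> nth 0 X k <= n by move=> lt; apply/leX/mem_nth.
have [ltj|ltj|eqj] := ltngtP j.+1 (size X).
- by rewrite /= addbF.
- rewrite ltnS in ltj; rewrite /= addbF /cross /=.
  rewrite (onth_default ltj) /=.
  case: (j =P size X) => /= [eqj|_].
    case: (ltnP j (size Y)) => ltjY; last by rewrite (onth_default ltjY).
    rewrite (onth_some 0 ltjY) /=.
    case: (ltnP j.+1 (size Y)) => ltjY'; last first.
      by rewrite (onth_default ltjY') /= !andbF.
    by rewrite (onth_some 0 ltjY') /=; have := leYn _ ltjY'; lia.
  by rewrite /= !andbF.
have ltjX : j < size X by rewrite -eqj.
rewrite -!nth_last -eqj /= (onth_some 0 ltjX).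
rewrite (@onth_default _ j.+1 X) /cross /=; last by rewrite eqj.
have [ltjY|ltjY|eqjY] := ltngtP (size X) (size Y).
- rewrite -eqj in ltjY; rewrite (onth_some 0 ltjY) (onth_some 0 (ltnW ltjY)) /=.
  by have := leYn _ ltjY; have := leXn _ ltjX; lia.
- have ltY : size Y <= j by lia.
  by rewrite (onth_default ltY) (_ : (j.+1 == size Y) = false) //; lia.
(* Equal sizes: both last arcs ended at infinity and did not cross; that of [X] now ends at
   [n.+1]. *)
have ltY : j < size Y by lia.
rewrite -eqjY -eqj (onth_some 0 ltY) (@onth_default _ j.+1 Y) /=; last lia.
by have := leYn _ ltY; have := leXn _ ltjX; lia.
Qed.

Lemma interlace_rcons X Y n :
    {in X, forall k, k <= n} -> {in Y, forall k, k <= n} ->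
  interlace (rcons X n.+1) Y =
  interlace X Y + (size X == size Y) && (last 0 X < last 0 Y).
Proof.
move=> leX leY.
rewrite (interlace_widen (n := size X + size Y + 1)); last first.
  by rewrite size_rcons; lia.
rewrite (interlace_widen (n := size X + size Y + 1)); last lia.
set P := fun j => cross (jth_arc X j) _.
pose B (j : nat) := [&& j == size X, size X == size Y & last 0 X < last 0 Y].
(* At the index of a new crossing both arcs used to end at infinity, so nothing was counted there
   and the two counts add. *)
have PB j : P j && B j = false.
  rewrite /P /B; case: (j =P size X) => [->|_]; last by rewrite andbF.
  case: (size X =P size Y) => [eqXY|_]; last by rewrite andbF.
  have nY : onth Y (size X) = None by rewrite eqXY onth_default.
  rewrite /jth_arc (onth_default (leqnn _)) nY.
  by rewrite /cross /= !andbF.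
transitivity (count (predU P B) (iota 1 (size X + size Y + 1))).
  apply: eq_in_count => j; rewrite mem_iota => /andP[j0 _].
  rewrite cross_rcons //= -/(P j) -/(B j).
  by move: (PB j); case: (P j) => //= ->.
have := count_predUI P B (iota 1 (size X + size Y + 1)).
rewrite (eq_count PB) count_pred0 addn0 => ->; congr (_ + _).
rewrite /B; case: (size X =P size Y) => [eqXY|_] /=; last first.
  by rewrite (eq_count (a2 := pred0)) ?count_pred0 // => j; rewrite /= andbF.
case: (ltnP (last 0 X) (last 0 Y)) => ltXY /=; last first.
  by rewrite (eq_count (a2 := pred0)) ?count_pred0 // => j; rewrite /= andbF.
rewrite (eq_count (a2 := pred1 (size X))) => [|j /=]; last by rewrite andbT.
rewrite count_uniq_mem ?iota_uniq // mem_iota.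
(* Two empty lists would both have the default last entry 0, against [ltXY]. *)
suff: 0 < size X by lia.
by case: (X) (Y) eqXY ltXY => [|? ?] [].
Qed.

Lemma last_positions b u : last 0 (positions b u) <= size u.
Proof.
have := @mem_last _ 0 (positions b u); rewrite inE => /predU1P[-> //|].
by move/mem_positions/andP=> [].
Qed.

(** The larger last entry belongs to the letter of the final step, the head of [u]. For empty [u]
    the defaults agree: both last entries are 0 and the head is [c]. *)
Lemma last_positions_lt c u : size (positions c u) = size (positions (~~ c) u) ->
  (last 0 (positions c u) < last 0 (positions (~~ c) u)) = (head c u != c).
Proof.
case: u => [|a u] //=; first by rewrite eqxx.
have := last_positions c u; have := last_positions (~~ c) u.
by case: a; case: c => /=; rewrite ?last_rcons; lia.
Qed.

(** Each step appends a new maximum to one of the two lists, which creates a crossing exactly when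
    the step completes a bounce. *)
Lemma interlace_positions u :
  interlace (positions true u) (positions false u) = bounce_count u.
Proof.
elim: u => //= c u IHu.
have le b : {in positions b u, forall k, k <= size u}.
  by move=> k /mem_positions/andP[].
have step : interlace (rcons (positions c u) (size u).+1) (positions (~~ c) u) =
            bounce_count (c :: u).
  rewrite interlace_rcons // [bounce_count _]/= addnC; congr (_ + _).
    rewrite /bounces excess_positions.
    case: (size (positions c u) =P size (positions (~~ c) u)) => eqs /=.
      rewrite last_positions_lt //.
      by case: (c) eqs => /= ->; rewrite subrr eqxx.
    by case: eqP => //=; case: (c) eqs => /=; lia.
  by rewrite -IHu; case: (c) => //=; rewrite interlaceC.
by case: c step => //= <-; rewrite interlaceC.
Qed.

(** Arcs of [X] with different indices start at different entries, so [undup] removes nothing. *)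
Lemma size_interlacings X Y : uniq X ->
  size (interlacings [:: X; Y]) = interlace X Y.
Proof.
move=> uX; rewrite /interlacings /block_pairs /= cats0.
rewrite undup_id.
  by rewrite size_filter count_map; apply: eq_count.
apply: filter_uniq; rewrite map_inj_in_uniq ?iota_uniq // => j j'.
rewrite !mem_iota => /andP[j0 ltj] /andP[j'0 ltj'] [eqj _ _ _].
suff: j.-1 = j'.-1 by case: (j) (j') j0 j'0 => [|?] [|?] //= _ _ ->.
apply: onth_inj eqj => //; rewrite gtn_min; apply/orP; right.
by case: (j) j0 ltj => //= k _; rewrite add1n ltnS leq_min => /andP[].
Qed.

(** Avoids deciding which of two blocks has the smaller least element, since [interlace] is
    symmetric. *)
Lemma perm_eq2 (T : eqType) (s : seq T) x y :
  perm_eq s [:: x; y] -> s = [:: x; y] \/ s = [:: y; x].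
Proof.
move=> eqs; have := perm_size eqs; case: s eqs => [|a [|b [|]]] //= eqs _.
have: a \in [:: x; y] by rewrite -(perm_mem eqs) mem_head.
rewrite !inE => /orP[] /eqP ea; subst a.
  by left; move: eqs; rewrite perm_cons => /perm_small_eq -> .
right; have: perm_eq [:: y; b] [:: y; x].
  by rewrite (perm_trans eqs) // (perm_catC [:: x] [:: y]).
by rewrite perm_cons => /perm_small_eq ->.
Qed.

(** * Subsets of the ground set as words *)

Lemma mem_elements n (A : {set 'I_n}) (x : 'I_n) :
  (x.+1 \in elements A) = (x \in A).
Proof.
rewrite mem_sort; apply/mapP/idP => [[y]|xA].
  by rewrite mem_enum => yA [/val_inj ->].
by exists x; rewrite ?mem_enum.
Qed.

Lemma sorted_elements n (A : {set 'I_n}) : sorted ltn (elements A).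
Proof.
rewrite ltn_sorted_uniq_leq sort_uniq sort_sorted ?andbT; last exact: leq_total.
by rewrite map_inj_uniq ?enum_uniq // => x y [/val_inj].
Qed.

Lemma elements_filter n (A : {set 'I_n}) :
  elements A = [seq k <- iota 1 n | k \in elements A].
Proof.
apply: (irr_sorted_eq ltn_trans ltnn (sorted_elements A)).
  by rewrite sorted_filter ?iota_ltn_sorted //; exact: ltn_trans.
move=> k; rewrite mem_filter; case kA: (k \in elements A) => //=.
move: kA; rewrite mem_sort => /mapP[x _ ->].
by rewrite mem_iota add1n !ltnS /= ltn_ord.
Qed.

Lemma elementsC n (A : {set 'I_n}) :
  elements (~: A) = [seq k <- iota 1 n | k \notin elements A].
Proof.
rewrite elements_filter; apply: eq_in_filter => k; rewrite mem_iota.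
case: k => // k /andP[_ ltk]; rewrite add1n ltnS in ltk.
by rewrite -[k]/(val (Ordinal ltk)) !mem_elements inE.
Qed.

Lemma size_elements n (A : {set 'I_n}) : size (elements A) = #|A|.
Proof. by rewrite size_sort size_map cardE. Qed.

Lemma uniq_elements n (A : {set 'I_n}) : uniq (elements A).
Proof. exact: sorted_uniq ltn_trans ltnn _ (sorted_elements A). Qed.

Definition word n (A : {set 'I_n}) : seq bool :=
  rev [seq k \in elements A | k <- iota 1 n].

Lemma size_word n (A : {set 'I_n}) : size (word A) = n.
Proof. by rewrite size_rev size_map size_iota. Qed.

Lemma positions_true_word n (A : {set 'I_n}) :
  positions true (word A) = elements A.
Proof.
rewrite positions_rev_map [RHS]elements_filter.
by apply: eq_filter => k; rewrite eqb_id.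
Qed.

Lemma positions_false_word n (A : {set 'I_n}) :
  positions false (word A) = elements (~: A).
Proof.
by rewrite positions_rev_map elementsC; apply: eq_filter => k; rewrite eqbF_neg.
Qed.

Lemma word_inj n : injective (@word n).
Proof.
move=> A B eqAB; apply/setP => x.
by rewrite -!mem_elements -!positions_true_word eqAB.
Qed.

Lemma word_surj n u : size u = n -> exists A : {set 'I_n}, word A = u.
Proof.
move=> sz_u; exists [set x : 'I_n | nth false (rev u) x].
rewrite -[RHS]revK; congr rev.
apply: (@eq_from_nth _ false); rewrite size_map size_iota ?size_rev // => k ltk.
rewrite (nth_map 0) ?size_iota // nth_iota // add1n.
by rewrite -[k]/(val (Ordinal ltk)) mem_elements inE.
Qed.

(** * Set partitions with at most two blocks *)

(* Removing [set0] covers the case [s = 0], where there is a single block. *)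
Definition bipartition n (A : {set 'I_n}) : {set {set 'I_n}} :=
  [set A; ~: A] :\ set0.

Lemma bipartitionP n (A : {set 'I_n}) : partition (bipartition A) [set: 'I_n].
Proof.
apply/and3P; split; last by rewrite !inE eqxx.
  apply/eqP/setP => x; rewrite inE; apply/bigcupP.
  have [xA|xA] := boolP (x \in A).
    exists A => //; rewrite !inE eqxx andbT.
    by apply/set0Pn; exists x.
  exists (~: A); rewrite !inE ?eqxx ?orbT ?andbT //.
  by apply/set0Pn; exists x; rewrite inE.
apply/trivIsetP => B C; rewrite !inE.
move=> /andP[_ /orP[]/eqP->] /andP[_ /orP[]/eqP->]; rewrite ?eqxx //.
  by rewrite -setI_eq0 setICr.
by rewrite -setI_eq0 setIC setICr.
Qed.

(** Removing [A] leaves a partition of [~: A] with at most one block: it is empty, or its block is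
    [~: A]. *)
Lemma partition_bipartition n (P : {set {set 'I_n}}) (A : {set 'I_n}) :
  partition P [set: 'I_n] -> A \in P -> #|P| <= 2 -> P = bipartition A.
Proof.
move=> partP AP; rewrite (cardsD1 A) AP ltnS => leP.
have A0 := partition_neq0 partP AP.
have partA : partition (P :\ A) (~: A) by rewrite -setTD; apply: partitionD1.
rewrite -(setD1K AP) /bipartition; case: (posnP #|P :\ A|) => [/eqP|gtP].
  rewrite cards_eq0 => /eqP P0; rewrite P0.
  have -> : ~: A = set0 by rewrite -(cover_partition partA) P0 /cover big_set0.
  apply/setP => B; rewrite !inE orbF.
  by case: (B =P A) => [->|_]; rewrite ?A0 //= andNb.
have /cards1P[B PB] : #|P :\ A| == 1 by rewrite eqn_leq leP.
have defB : B = ~: A by rewrite -(cover_partition partA) PB cover1.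
have B0 : B != set0 by apply: (partition_neq0 partA); rewrite PB set11.
rewrite PB -defB; apply/setP => C; rewrite !inE.
case: (C =P set0) => [->|] //=.
by rewrite ![set0 == _]eq_sym (negPf A0) (negPf B0).
Qed.

Lemma perm_enum_bipartition n (A : {set 'I_n}) : A != set0 -> ~: A != set0 ->
  perm_eq (enum (bipartition A)) [:: A; ~: A].
Proof.
move=> A0 AC0; apply: uniq_perm; rewrite ?enum_uniq //=.
  rewrite inE andbT; apply: contraNneq A0 => eqA.
  by rewrite -(setIid A) {2}eqA setICr.
move=> B; rewrite mem_enum !inE.
case: (B =P set0) => [->|] //=.
by rewrite ![set0 == _]eq_sym (negPf A0) (negPf AC0).
Qed.

Lemma bipartitionT n : 0 < n -> bipartition [set: 'I_n] = [set [set: 'I_n]].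
Proof.
move=> n0; have T0 : [set: 'I_n] != set0 by rewrite -card_gt0 cardsT card_ord.
apply/setP => B; rewrite !inE setCT.
by case: (B =P set0) => [->|] /=; rewrite ?orbF // eq_sym (negPf T0).
Qed.

Lemma interlacing_number_bipartition n (A : {set 'I_n}) : A != set0 ->
  interlacing_number (bipartition A) = interlace (elements A) (elements (~: A)).
Proof.
move=> A0; rewrite /interlacing_number /blocks.
have [AC0|AC0] := eqVneq (~: A) set0.
  have AT : A = setT by rewrite -[A]setCK AC0 setC0.
  rewrite /interlace !size_elements AC0 cards0 minn0 /= AT bipartitionT.
    by rewrite /image_mem enum_set1.
  by move: A0; rewrite -card_gt0 AT cardsT card_ord.
set le := (fun _ _ => _); set s := [seq elements B | B in _].
have: perm_eq (sort le s) [:: elements A; elements (~: A)].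
  rewrite perm_sort; exact: (perm_map _ (perm_enum_bipartition A0 AC0)).
case/perm_eq2 => ->; rewrite size_interlacings ?uniq_elements //.
exact: interlaceC.
Qed.

Lemma shape_of_bipartition n (A : {set 'I_n}) : #|~: A| < #|A| ->
  shape_of (bipartition A) = two_row_shape #|A| #|~: A|.
Proof.
move=> ltA; have A0 : A != set0 by rewrite -card_gt0 (leq_ltn_trans _ ltA).
rewrite /shape_of /two_row_shape /= card_gt0 A0.
have [AC0|AC0] := eqVneq (~: A) set0.
  have AT : A = setT by rewrite -[A]setCK AC0 setC0.
  rewrite AC0 cards0 /= AT bipartitionT; first by rewrite /image_mem enum_set1.
  by move: A0; rewrite -card_gt0 AT cardsT card_ord.
rewrite card_gt0 AC0 /=.
apply: (@sorted_eq _ geq) => /=.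
- by move=> y x z /= xy yz; apply: leq_trans yz xy.
- by move=> x y /= /anti_leq.
- by apply: sort_sorted => x y /=; exact: leq_total.
- by rewrite ltnW.
rewrite perm_sort; exact: (perm_map _ (perm_enum_bipartition A0 AC0)).
Qed.

(** Reduces a set partition to its large block: the shape allows at most two blocks, and the one of
    size [r] determines the other. *)
Lemma setpartP r s i (P : {set {set 'I_(r + s)}}) : s < r ->
  reflect (exists A, [/\ P = bipartition A, #|A| = r
                       & bounce_count (word A) = i])
    [&& partition P [set: 'I_(r + s)],
        shape_of P == two_row_shape r s
      & interlacing_number P == i].
Proof.
move=> ltsr.
have cardC (A : {set 'I_(r + s)}) : #|A| = r -> #|~: A| = s.
  by move=> cA; have := cardsC A; rewrite cA card_ord => /addnI.
have number (A : {set 'I_(r + s)}) : #|A| = r ->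
    interlacing_number (bipartition A) = bounce_count (word A).
  move=> cA; rewrite interlacing_number_bipartition -?card_gt0 ?cA; last lia.
  by rewrite -interlace_positions positions_true_word positions_false_word.
apply: (iffP and3P) => [[partP /eqP shP /eqP numP]|[A [-> cA bA]]]; last first.
  split; first exact: bipartitionP.
    by rewrite shape_of_bipartition cA cardC.
  by rewrite number ?bA.
have leP : #|P| <= 2.
  have := congr1 size shP; rewrite size_sort size_map -cardE => ->.
  by rewrite size_filter count_size.
(* Since [s < r], the part [r] is positive and survives the dropping of zero parts. *)
have /mapP[A AP cA] : r \in [seq #|A : {set _}| | A in P].
  rewrite -(mem_sort geq) -/(shape_of P) shP mem_filter mem_head andbT; lia.
rewrite mem_enum in AP; have defP := partition_bipartition partP AP leP.
by exists A; split=> //; rewrite -numP defP number.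
Qed.

(** The large block is recovered by its size: [B] is [A] or [~: A], and the latter is too small. *)
Lemma bipartition_inj n (A B : {set 'I_n}) :
  #|~: A| < #|A| -> #|B| = #|A| -> bipartition A = bipartition B -> A = B.
Proof.
move=> ltA cB eqAB.
have: B \in bipartition A.
  by rewrite eqAB !inE eqxx andbT -card_gt0 cB; lia.
rewrite !inE => /andP[_ /orP[/eqP-> //|/eqP defB]].
by move: ltA; rewrite -defB cB ltnn.
Qed.

(** * Tableaux as words, and the bijection *)

Lemma is_syt2_positions v (a b : int) :
  is_syt2 a b (positions true v, positions false v) =
  [&& (size (positions true v))%:Z%R == a, (size (positions false v))%:Z%R == b
    & ballot v].
Proof.
rewrite /is_syt2 /= -column_strict_positions /column_strict.
by rewrite size_positionsD perm_positions !sorted_positions.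
Qed.

(** The first row gives the up-steps; the second is the increasing list of the remaining numbers. *)
Lemma is_syt2_word (a b : int) T : is_syt2 a b T ->
  exists v, T = (positions true v, positions false v).
Proof.
case: T => X Y /and5P[_ _ _ perm /and3P[sX sY _]]; simpl in *.
exists (rev [seq k \in X | k <- iota 1 (size X + size Y)]).
have uXY : uniq (X ++ Y) by rewrite (perm_uniq perm) iota_uniq.
have mXY := perm_mem perm.
rewrite !positions_rev_map.
have s_f (p : pred nat) : sorted ltn [seq k <- iota 1 (size X + size Y) | p k].
  by rewrite sorted_filter ?iota_ltn_sorted //; exact: ltn_trans.
congr pair; apply: (irr_sorted_eq ltn_trans ltnn) => // k;
  rewrite mem_filter -mXY mem_cat.
  by case: (k \in X).
move: uXY; rewrite cat_uniq => /and3P[_ /hasPn XY _].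
case kY: (k \in Y); last by case: (k \in X).
by rewrite orbT andbT; have /negPf -> := XY k kY.
Qed.

Lemma inj_surj_bij (T : choiceType) (U : eqType) (f : T -> U) :
  injective f -> (forall y, exists x, f x = y) -> bijective f.
Proof.
move=> f_inj f_surj.
have f_surjb y : exists x, f x == y by have [x <-] := f_surj y; exists x.
have fK : cancel (fun y => xchoose (f_surjb y)) f.
  by move=> y; apply/eqP/(xchooseP (f_surjb y)).
by exists (fun y => xchoose (f_surjb y)) => // x; apply: f_inj; rewrite fK.
Qed.

Theorem theorem3p24 (r s i : nat) (hrs : s < r) :
  exists f : setpart r s i -> syt2 (r%:Z + i%:Z)%R (s%:Z - i%:Z)%R, bijective f.
Proof.
have block (P : setpart r s i) : exists A : {set 'I_(r + s)},
    [&& sval P == bipartition A, #|A| == r & bounce_count (word A) == i].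
  case: P => P /= /(setpartP _ _ hrs)[A [-> cA bA]].
  by exists A; rewrite cA bA !eqxx.
pose path P := word (xchoose (block P)).
have pathP P : [/\ excess (path P) = (r%:Z - s%:Z)%R, size (path P) = r + s
                & bounce_count (path P) = i].
  have /and3P[_ /eqP cA /eqP bA] := xchooseP (block P).
  split=> //; last exact: size_word.
  rewrite excess_positions positions_true_word positions_false_word.
  by rewrite !size_elements cA cardsCs setCK cA card_ord addKn.
(* The end height [r - s] is nonzero, so a further step creates no bounce; the [true] passed to
   [to_ballot] below is an arbitrary choice. *)
have no_bounce u c : excess u = (r%:Z - s%:Z)%R ->
    bounce_count (c :: u) = bounce_count u.
  by move=> Eu; rewrite /= /bounces Eu; case: eqP => //; lia.
pose tab P := let v := to_ballot true (path P) in
  (positions true v, positions false v).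
have tabP P : is_syt2 (r%:Z + i%:Z)%R (s%:Z - i%:Z)%R (tab P).
  have [Eu szu bu] := pathP P.
  have := excess_to_ballot true (path P); rewrite no_bounce // Eu bu.
  (* The row lengths have sum [r + s] and difference [r - s + 2 i]. *)
  have := size_positionsD (to_ballot true (path P)).
  rewrite size_to_ballot szu excess_positions.
  rewrite is_syt2_positions ballot_to_ballot andbT .
  by move: (size _) (size _) => y x; lia.
exists (fun P => exist _ (tab P) (tabP P) : syt2 _ _); apply: inj_surj_bij.
  move=> P Q [/positions_true_inj eq_v _].
  have [[EP szP _] [EQ szQ _]] := (pathP P, pathP Q).
  have /word_inj eqA : path P = path Q.
    apply: (@to_ballot_inj true); first by rewrite EP.
    by apply: eq_v; rewrite !size_to_ballot szP.
  have /and3P[/eqP defP _ _] := xchooseP (block P).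
  have /and3P[/eqP defQ _ _] := xchooseP (block Q).
  by apply: val_inj; rewrite /= defP eqA -defQ.
case=> T sytT; have [v defT] := is_syt2_word sytT.
have := sytT; rewrite {1}defT is_syt2_positions.
case/and3P=> /eqP szX /eqP szY balv.
have szv : size v = r + s by rewrite -size_positionsD; lia.
have [|u [Eu bu defv]] := @to_ballot_surj true v (r%:Z - s%:Z)%R i balv.
  by rewrite excess_positions; lia.
have szu : size u = r + s by rewrite -szv -defv size_to_ballot.
have [A defA] := word_surj szu.
have cA : #|A| = r.
  rewrite -size_elements -positions_true_word defA.
  move: Eu; have := size_positionsD u.
  by rewrite szu excess_positions; lia.
have PA : [&& partition (bipartition A) [set: 'I_(r + s)],
              shape_of (bipartition A) == two_row_shape r s
            & interlacing_number (bipartition A) == i].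
  by apply/setpartP => //; exists A; split=> //; rewrite defA -bu no_bounce.
pose P : setpart r s i := exist _ (bipartition A) PA.
exists P; apply: val_inj; rewrite /= /tab.
(* The block chosen for [P] must be [A], the large block being unique. *)
suff -> : path P = u by rewrite defv defT.
have /and3P[/eqP defP /eqP cB _] := xchooseP (block P).
rewrite /path -defA; congr word; apply/esym/bipartition_inj => //.
  by rewrite cardsCs setCK cA card_ord addKn.
by rewrite cA.
Qed.
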